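(* Let $M=\gamma$ be a smooth curve in $\mathbb{R}^2$, $\gamma:[0,S]\to\mathbb{R}^2$, parametrized by arc length, let $x=\gamma(0)$, and write $\gamma''(0)=\kappa\,\mathbf{n}$ with $\mathbf{n}$ the unit normal vector of $\gamma$ at $x$ and $\kappa\neq 0$. Let $d_S$ be the spherical distance (defined in the context) associated with the osculating circle $C_x(c,r)$ of $\gamma$ at $x$, where $r=\frac{1}{|\kappa|}$ and $c=x+\frac1\kappa\mathbf{n}$. Let $y=\gamma(s)$, so that $d_M(x,y)=s$. Then $$d_S(x,y)=s+O(s^4)\qquad (s\to 0).$$
   Context: $d_M$ is the geodesic distance on $M$ (infimum of lengths of curves in $M$ joining two points). $C_x(c,r)$ is the circle in $\mathbb{R}^2$ with center $c$ and radius $r$; it passes through $x$. The projection $\pi:M\to C_x(c,r)$ is $\pi(z)=c+r\,\frac{z-c}{\|z-c\|}$ (defined for $z\neq c$, in particular near $x$). The spherical distance is $$d_S(x,y)=r\arccos\left\{\frac{\pi(x)-c}{r}\cdot\frac{\pi(y)-c}{r}\right\},$$ i.e. the geodesic distance on the circle between $\pi(x)=x$ and $\pi(y)$.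
   Formalization: The clause d_M(x,y)=s is proved for all s in [0,S] when γ is injective on [0,S], and for small s when γ is injective on [0,S), since it fails e.g. for a closed curve at s=S; the expansion of d_S needs no such assumption. *)

(* Defs.v *)
From HB Require Import structures.
From mathcomp Require Import all_boot all_order all_algebra.
From mathcomp Require Import all_classical all_reals all_analysis.

Set Implicit Arguments.
Unset Strict Implicit.
Unset Printing Implicit Defensive.

Import Order.TTheory GRing.Theory Num.Theory.
Import numFieldNormedType.Exports.

Local Open Scope classical_set_scope.
Local Open Scope ring_scope.

(* The library norm on 'rV[R]_2 is the sup norm; only the topology it induces
   is used, all lengths are measured with [enorm]. *)
Definition dotp (R : realType) (u v : 'rV[R]_2) : R :=
  \sum_(i < 2) u 0 i * v 0 i.

Definition enorm (R : realType) (u : 'rV[R]_2) : R := Num.sqrt (dotp u u).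

(* Difference quotient at t of a function considered on `[a, b] only: its
   limit along [within `[a, b] t^'] is the ordinary derivative at interior
   points and the one-sided derivative at a and b; the values of f outside
   `[a, b] play no role. *)
Definition diff_quot (R : realType) (f : R -> 'rV[R]_2) (t u : R) : 'rV[R]_2 :=
  (u - t)^-1 *: (f u - f t).

Definition derivable_on (R : realType) (a b : R) (f : R -> 'rV[R]_2) (t : R) :
    Prop :=
  cvg (diff_quot f t u @[u --> within `[a, b] t^']).

Definition derive_on (R : realType) (a b : R) (f : R -> 'rV[R]_2) (t : R) :
    'rV[R]_2 :=
  lim (diff_quot f t u @[u --> within `[a, b] t^']).

Definition derive_on_n (R : realType) (a b : R) (n : nat)
    (f : R -> 'rV[R]_2) : R -> 'rV[R]_2 :=
  iter n (derive_on a b) f.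

Definition smooth_on (R : realType) (a b : R) (f : R -> 'rV[R]_2) : Prop :=
  forall (n : nat) (t : R), t \in `[a, b] ->
    derivable_on a b (derive_on_n a b n f) t.

Definition arc_length_param (R : realType) (a b : R) (f : R -> 'rV[R]_2) :
    Prop :=
  forall t : R, t \in `[a, b] -> enorm (derive_on a b f t) = 1.

Definition unit_normal_at (R : realType) (a b : R) (f : R -> 'rV[R]_2) (t : R)
    (n : 'rV[R]_2) : Prop :=
  enorm n = 1 /\ dotp n (derive_on a b f t) = 0.

(* Polygonal length; same partitions and indexing as the library's
   [variation], which is restricted to real-valued functions. *)
Definition polygonal_length (R : realType) (a : R) (sigma : R -> 'rV[R]_2)
    (p : seq R) : R :=
  \sum_(0 <= k < size p)
    enorm (sigma (nth a (a :: p) k.+1) - sigma (nth a (a :: p) k)).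

Definition curve_length (R : realType) (a b : R) (sigma : R -> 'rV[R]_2) :
    \bar R :=
  ereal_sup [set (polygonal_length a sigma p)%:E | p in [set p | itv_partition a b p]].

Definition path_in (R : realType) (M : set 'rV[R]_2) (x y : 'rV[R]_2)
    (sigma : R -> 'rV[R]_2) : Prop :=
  [/\ {within `[0, 1], continuous sigma},
      (forall t : R, t \in `[0, 1] -> M (sigma t)),
      sigma 0 = x & sigma 1 = y].

(* d_M; equal to +oo when no path of finite length joins x to y in M. *)
Definition geodesic_dist (R : realType) (M : set 'rV[R]_2) (x y : 'rV[R]_2) :
    \bar R :=
  ereal_inf [set curve_length 0 1 sigma | sigma in [set sigma | path_in M x y sigma]].

(* Since 0^-1 = 0, this sends the excluded point z = c to c. *)
Definition circle_proj (R : realType) (c : 'rV[R]_2) (r : R) (z : 'rV[R]_2) :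
    'rV[R]_2 :=
  c + r *: ((enorm (z - c))^-1 *: (z - c)).

Definition sphere_dist (R : realType) (c : 'rV[R]_2) (r : R)
    (x y : 'rV[R]_2) : R :=
  r * acos (dotp (r^-1 *: (circle_proj c r x - c))
                 (r^-1 *: (circle_proj c r y - c))).

(* Main.v *)
Require Import Defs.
From mathcomp Require Import all_boot all_order all_algebra.
From mathcomp Require Import all_classical all_reals all_analysis.
From mathcomp Require Import ring lra.

Import Order.TTheory GRing.Theory Num.Theory.
Import numFieldNormedType.Exports.

Local Open Scope classical_set_scope.
Local Open Scope ring_scope.

Set Implicit Arguments.
Unset Strict Implicit.
Unset Printing Implicit Defensive.

(** The theorem has a metric half, which identifies the arc-length parameter with
the geodesic distance, and an analytic half, the expansion of the spherical
distance.

Geodesic distance.  Running along the curve from [f 0] to [f s] costs at most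
[s], because a unit-speed curve is 1-Lipschitz ([arc_length_lipschitz]).  For
the lower bound take a 1-Lipschitz function [phi] of the parameter that takes
the same value at all parameters of a point, so that it is a function on the
trace of the curve, and that is even constant near the parameters of a multiple
point.  Chords of the curve between close parameters are almost as long as the
arcs they cut off, and the remaining short chords join the two branches at a
multiple point, where [phi] does not change.  By compactness [phi] is therefore
[(1 + e)]-Lipschitz for all sufficiently short chords
([arc_length_chord_bound]).  Summing along a fine subdivision of an arbitrary
path shows that its length is at least [phi s - phi 0], up to the factor
[1 + e] ([arc_length_le_geodesic_dist]).  It remains to choose [phi] with
[phi s - phi 0] close to [s]: the identity when the curve is injective,
[min t s] when the end point meets the curve, if at all, only at parameters
beyond [s], and
[max 0 (min t (S - t) s - e)] when the curve is closed.

Spherical distance.  Let [T] and [n] be the tangent and the normal at the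
origin [x] of the curve, and [(a, b)] the coordinates of [f s - x] in this
frame.  Seen from the center of the osculating circle, [f s] makes with [x] the
angle [theta = atan (kappa a / (1 - kappa b))], and the spherical distance is
[|theta| / |kappa|] ([sphere_dist_atan]).  The derivative of
[theta - kappa s] is [kappa N / D] with
[D = (1 - kappa b)^2 + kappa^2 a^2], which tends to 1, and
[N = a' (1 - kappa b) + kappa a b' - D].  At 0 one has [a' = 1], [a'' = 0],
[b' = 0], [b'' = kappa] and, by differentiating twice [|f'|^2 = 1],
[a''' = - kappa^2] ([arc_length_third_derivative]); hence [N], [N'] and [N'']
vanish at 0 whatever [b'''] is, and [N = O(s^3)]
([osculating_defect_bigO]).  Integrating once more,
[theta = kappa s + O(s^4)] ([osculating_angle_bigO]). *)

(** * One-sided derivatives on a segment *)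

Lemma cvg_near_eq (T : Type) (R : realType) (F : set_system T) (f g : T -> R)
    (l : R) {FF : Filter F} : f @ F --> l -> (\forall x \near F, f x = g x) ->
  g @ F --> l.
Proof. by move=> fl fg; apply: cvg_trans fl; exact: near_eq_cvg. Qed.

(** Scalar counterpart of [derivable_on] and [derive_on]: differentiability on a
closed segment, one-sided at its ends, as a relation between [f] and its
derivative, so that derivatives can be computed without mentioning limits. *)
Definition has_slope_on (R : realType) (a b : R) (f f' : R -> R) : Prop :=
  forall t, t \in `[a, b] ->
    (u - t)^-1 * (f u - f t) @[u --> within `[a, b] t^'] --> f' t.

Lemma cvg_within_dnbhs (R : realType) (A : set R) (t : R) (f : R -> R)
    (l : R) : f u @[u --> within A (nbhs t)] --> l ->
  f u @[u --> within A t^'] --> l.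
Proof.
move=> fl U /fl; rewrite /nbhs/= /within/= /dnbhs/= /within/=.
by apply: filterS => u fu _.
Qed.

Lemma has_slope_on_continuous (R : realType) (a b : R) (f f' : R -> R) :
  has_slope_on a b f f' -> {within `[a, b], continuous f}.
Proof.
move=> ff'; apply/subspace_continuousP => t tab.
have cvg_dnbhs : f u @[u --> within `[a, b] t^'] --> f t.
  have ut : (u - t) @[u --> within `[a, b] t^'] --> 0.
    rewrite -(subrr t); apply: (cvgB (f := id)); last exact: cvg_cst.
    by apply: cvg_within_dnbhs; apply: cvg_within_filter; exact: cvg_id.
  (* [f u] is written as [(u - t)] times the difference quotient plus [f t]. *)
  rewrite -[f t]add0r -[0](mul0r (f' t)).
  apply: (cvg_near_eq (cvgD (cvgM ut (ff' t tab)) (cvg_cst (f t)))).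
  rewrite near_withinE /dnbhs near_withinE; near=> u => /= ut0 _.
  by rewrite !fctE/=; field; rewrite subr_eq0.
apply/cvgrPdist_lt => e e0; have /cvgrPdist_lt/(_ e e0) := cvg_dnbhs.
rewrite !near_withinE; apply: filter_app; near=> u => ute uab.
by have [->|/ute] := eqVneq u t; [rewrite subrr normr0|apply].
Unshelve. all: end_near. Qed.

Lemma has_slope_on_subitv_continuous (R : realType) (a b c d : R)
    (f f' : R -> R) : a <= c -> d <= b -> has_slope_on a b f f' ->
  {within `[c, d], continuous f}.
Proof.
move=> ac db /has_slope_on_continuous; apply: continuous_subspaceW.
by apply: subset_itvScc.
Qed.

Lemma has_slope_on_is_derive (R : realType) (a b t : R) (f f' : R -> R) :
  has_slope_on a b f f' -> t \in `]a, b[ -> is_derive t 1 f (f' t).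
Proof.
move=> ff' tab.
have : h^-1 *: ((f \o shift t) (h *: 1) - f t) @[h --> 0^'] --> f' t.
  have ht : (h + t) @[h --> 0^'] --> within `[a, b] t^'.
    move=> U; rewrite /nbhs/= /dnbhs /within/= => Ut; rewrite near_simpl.
    have /nbhs0P := Ut; have /near_in_itvoo/nbhs0P := tab.
    apply: filter_app2.
    near=> h => /= /subset_itv_oo_cc thab Uth h0; rewrite addrC; apply: Uth => //.
    by rewrite -subr_eq0 addrC addKr.
  have := cvg_comp _ _ ht (ff' t (subset_itv_oo_cc tab)).
  by move=> qt; apply: (cvg_near_eq qt); near=> h; rewrite /= addrK /GRing.scale/= mulr1.
move=> ft; split; [exact: cvgP ft|exact: cvg_lim].
Unshelve. all: end_near. Qed.

Lemma has_slope_on_cst (R : realType) (a b k : R) :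
  has_slope_on a b (fun=> k) (fun=> 0).
Proof.
move=> t _; apply: (cvg_near_eq (cvg_cst 0)).
by near=> u; rewrite subrr mulr0.
Unshelve. all: end_near. Qed.

Lemma has_slope_onD (R : realType) (a b : R) (f f' g g' : R -> R) :
  has_slope_on a b f f' -> has_slope_on a b g g' ->
  has_slope_on a b (fun t => f t + g t) (fun t => f' t + g' t).
Proof.
move=> ff' gg' t tab; apply: (cvg_near_eq (cvgD (ff' t tab) (gg' t tab))).
by near=> u; rewrite !fctE/=; ring.
Unshelve. all: end_near. Qed.

Lemma has_slope_onM (R : realType) (a b : R) (f f' g g' : R -> R) :
  has_slope_on a b f f' -> has_slope_on a b g g' ->
  has_slope_on a b (fun t => f t * g t) (fun t => f' t * g t + f t * g' t).
Proof.
move=> ff' gg' t tab.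
have fu : f u @[u --> within `[a, b] t^'] --> f t.
  have /subspace_continuousP/(_ t tab) := has_slope_on_continuous ff'.
  exact: cvg_within_dnbhs.
apply: (cvg_near_eq (cvgD (cvgM (ff' t tab) (cvg_cst (g t))) (cvgM fu (gg' t tab)))).
by near=> u; rewrite !fctE/=; ring.
Unshelve. all: end_near. Qed.

Lemma has_slope_on_eq (R : realType) (a b : R) (f g g' : R -> R) :
  has_slope_on a b f g -> {in `[a, b], g =1 g'} -> has_slope_on a b f g'.
Proof. by move=> fg gg' t tab; rewrite -gg'//; exact: fg. Qed.

Lemma has_slope_onB (R : realType) (a b : R) (f f' g g' : R -> R) :
  has_slope_on a b f f' -> has_slope_on a b g g' ->
  has_slope_on a b (fun t => f t - g t) (fun t => f' t - g' t).
Proof.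
move=> ff' gg' t tab; apply: (cvg_near_eq (cvgB (ff' t tab) (gg' t tab))).
by near=> u; rewrite !fctE/=; ring.
Unshelve. all: end_near. Qed.

Lemma has_slope_onZ (R : realType) (a b k : R) (f f' : R -> R) :
  has_slope_on a b f f' ->
  has_slope_on a b (fun t => k * f t) (fun t => k * f' t).
Proof.
move=> ff' t tab; have := has_slope_onM (@has_slope_on_cst R a b k) ff' tab.
by rewrite mul0r add0r.
Qed.

Lemma has_slope_on_MVT (R : realType) (a b c d : R) (f f' : R -> R) :
  a <= c -> c < d -> d <= b -> has_slope_on a b f f' ->
  exists2 t, t \in `]c, d[ & f d - f c = f' t * (d - c).
Proof.
move=> ac cd db ff'; apply: MVT => //; last exact: has_slope_on_subitv_continuous ff'.
move=> t; rewrite in_itv/= => /andP[ct td]; apply: (has_slope_on_is_derive ff').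
by rewrite in_itv/= (le_lt_trans ac)// (lt_le_trans td).
Qed.

(** The point [t] may be an end of the segment, so this is not the uniqueness of
ordinary derivatives: it needs the one-sided difference quotients, hence
[a < b]. *)
Lemma has_slope_on_constant (R : realType) (a b k : R) (f f' : R -> R) :
  a < b -> has_slope_on a b f f' -> {in `[a, b], forall t, f t = k} ->
  {in `[a, b], forall t, f' t = 0}.
Proof.
move=> ab ff' fk t tab; apply: contrapT => /eqP f't0.
have /cvgrPdist_lt/(_ `|f' t|) := ff' t tab.
rewrite normr_gt0 f't0 => /(_ isT).
rewrite near_withinE /dnbhs near_withinE => /nbhs_ballP[d /= d0] near_t.
have [u uab /andP[ut utd]] : exists2 u, u \in `[a, b] & (u != t) && (`|t - u| < d).
  move: tab; rewrite in_itv/= => /andP[ta tb].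
  have [tltb|bt] := ltP t b.
    have [c [tc cb cd]] : exists c, [/\ t < c, c <= b & c < t + d].
      by have [?|?] := leP (t + d / 2) b; [exists (t + d / 2)|exists b]; split; lra.
    exists c; rewrite ?in_itv/=; first by apply/andP; split; lra.
    by rewrite gt_eqF//= distrC ger0_norm; lra.
  have [c [ct ac cd]] : exists c, [/\ c < t, a <= c & t - d < c].
    by have [?|?] := leP a (t - d / 2); [exists (t - d / 2)|exists a]; split; lra.
  exists c; rewrite ?in_itv/=; first by apply/andP; split; lra.
  by rewrite lt_eqF//= ger0_norm; lra.
have := near_t u utd ut uab.
by rewrite (fk u uab) (fk t tab) subrr mulr0 subr0 ltxx.
Qed.

(** Mean value inequality: a bound [K s^n] on the derivative over [0, s] gives
the bound [K s^n * s] on the increment. *)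
Lemma bigO_primitive (R : realType) (d : R) (n : nat) (F F' : R -> R) :
  0 < d -> {within `[0, d], continuous F} ->
  (forall s : R, s \in `]0, d[ -> is_derive s 1 F (F' s)) -> F 0 = 0 ->
  F' =O_ ((0 : R)^'+) (fun s => s ^+ n) ->
  F =O_ ((0 : R)^'+) (fun s => s ^+ n.+1).
Proof.
move=> d0 cF dF F0 /eqO_exP[K K0 F'K]; apply/eqO_exP; exists K => //.
move: F'K; rewrite !near_withinE => /nbhs_ballP[e /= e0 F'K].
apply/nbhs_ballP; exists (Num.min d e) => /=; first by rewrite lt_min d0.
move=> s; rewrite /ball/= sub0r normrN lt_min => /andP[sd se] s0.
rewrite gtr0_norm// in sd se.
have dFs t : t \in `]0, s[ -> is_derive t 1 F (F' t).
  rewrite in_itv/= => /andP[t0 ts]; apply: dF.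
  by rewrite in_itv/= t0 (lt_trans ts).
have cFs : {within `[0, s], continuous F}.
  apply: (continuous_subspaceW _ cF); apply: subset_itvScc.
    by rewrite bnd_simp.
  by rewrite bnd_simp ltW.
have [t ts] := MVT s0 dFs cFs.
rewrite F0 !subr0 => ->.
move: ts; rewrite in_itv/= => /andP[t0 ts].
have := F'K t; rewrite /ball/= sub0r normrN gtr0_norm// (lt_trans ts se).
move=> /(_ isT t0) F't.
rewrite normrM (gtr0_norm s0) exprSr normrM (gtr0_norm s0) mulrA.
apply: ler_wpM2r; first exact: ltW.
apply: le_trans F't _; apply: ler_wpM2l; first exact: ltW.
rewrite !normrX !gtr0_norm//; apply: lerXn2r; rewrite ?nnegrE; exact: ltW.
Qed.

(** * Euclidean geometry of the plane *)

Lemma dotpE (R : realType) (u v : 'rV[R]_2) :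
  dotp u v = u 0 0 * v 0 0 + u 0 1 * v 0 1.
Proof.
rewrite /dotp big_ord_recl big_ord_recl big_ord0 addr0.
by rewrite (_ : lift ord0 ord0 = 1)//; apply: val_inj.
Qed.

Lemma dotpBr (R : realType) (u v w : 'rV[R]_2) :
  dotp u (v - w) = dotp u v - dotp u w.
Proof. by rewrite !dotpE !mxE; ring. Qed.

Lemma dotp_ge0 (R : realType) (u : 'rV[R]_2) : 0 <= dotp u u.
Proof. by rewrite dotpE addr_ge0// -expr2 sqr_ge0. Qed.

Lemma enorm_ge0 (R : realType) (u : 'rV[R]_2) : 0 <= enorm u.
Proof. exact: sqrtr_ge0. Qed.

Lemma enorm_sqr (R : realType) (u : 'rV[R]_2) : enorm u ^+ 2 = dotp u u.
Proof. by rewrite sqr_sqrtr// dotp_ge0. Qed.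

Lemma enorm0 (R : realType) : enorm (0 : 'rV[R]_2) = 0.
Proof. by rewrite /enorm dotpE !mxE !mul0r addr0 sqrtr0. Qed.

Lemma enormN (R : realType) (u : 'rV[R]_2) : enorm (- u) = enorm u.
Proof. by rewrite /enorm !dotpE !mxE !mulrNN. Qed.

Lemma enorm_distC (R : realType) (u v : 'rV[R]_2) : enorm (u - v) = enorm (v - u).
Proof. by rewrite -enormN opprB. Qed.

(** Cauchy-Schwarz, from Lagrange's identity in dimension 2. *)
Lemma dotp_le_enorm (R : realType) (u v : 'rV[R]_2) :
  dotp u v <= enorm u * enorm v.
Proof.
rewrite -sqrtrM ?dotp_ge0//; apply: le_trans (ler_norm _) _.
rewrite -sqrtr_sqr; apply: ler_wsqrtr; rewrite -subr_ge0 !dotpE.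
set p := (X in 0 <= X).
suff -> : p = (u 0 0 * v 0 1 - u 0 1 * v 0 0) ^+ 2 by exact: sqr_ge0.
by rewrite /p; ring.
Qed.

Lemma coord_le_enorm (R : realType) (u : 'rV[R]_2) (i : 'I_2) :
  `|u 0 i| <= enorm u.
Proof.
rewrite -sqrtr_sqr; apply: ler_wsqrtr; rewrite /dotp (bigD1 i)//= expr2 lerDl.
by apply: sumr_ge0 => j _; rewrite -expr2 sqr_ge0.
Qed.

Lemma enorm_le_coord (R : realType) (u : 'rV[R]_2) (k : R) :
  (forall i, `|u 0 i| <= k) -> enorm u <= 2 * k.
Proof.
move=> uk; have k0 : 0 <= k by apply: le_trans (uk 0).
rewrite -(@ger0_norm _ (2 * k)) ?mulr_ge0// -sqrtr_sqr; apply: ler_wsqrtr.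
rewrite dotpE -!expr2 -![u _ _ ^+ 2]real_normK ?num_real//.
have := uk 0; have := uk 1; have := normr_ge0 (u 0 0); have := normr_ge0 (u 0 1).
by nra.
Qed.

(** Pythagoras in an orthonormal frame: in dimension 2, [n] is the quarter turn
of [T] up to a sign, which is the determinant [D] of the frame. *)
Lemma dotp_orthonormal (R : realType) (T n w : 'rV[R]_2) :
  enorm T = 1 -> enorm n = 1 -> dotp n T = 0 ->
  dotp w w = dotp T w ^+ 2 + dotp n w ^+ 2.
Proof.
move=> T1 n1 nT.
have TT : dotp T T = 1 by rewrite -enorm_sqr T1 expr1n.
have nn : dotp n n = 1 by rewrite -enorm_sqr n1 expr1n.
move: TT nn nT; rewrite !dotpE.
move: (T 0 0) (T 0 1) (n 0 0) (n 0 1) (w 0 0) (w 0 1) => a b c d x y TT nn nT.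
pose D := a * d - b * c.
have cE : c = - b * D.
  have -> : c = c * (a * a + b * b) by rewrite TT mulr1.
  have ca : c * a = - (d * b) by apply/eqP; rewrite -addr_eq0 nT.
  by rewrite mulrDr mulrA ca /D; ring.
have dE : d = a * D.
  have -> : d = d * (a * a + b * b) by rewrite TT mulr1.
  have db : d * b = - (c * a) by apply/eqP; rewrite -addr_eq0 addrC nT.
  by rewrite mulrDr [d * (b * b)]mulrA db /D; ring.
have DD : D * D = 1.
  by rewrite -nn {1}cE {1}dE cE dE -[LHS]mulr1 -TT; ring.
rewrite cE dE.
have -> : x * x + y * y = (a * a + b * b) * (x * x + y * y) by rewrite TT mul1r.
have -> : (- b * D * x + a * D * y) ^+ 2 = (D * D) * (a * y - b * x) ^+ 2 by ring.
by rewrite DD; ring.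
Qed.

(** Together with [enorm_le_coord], this compares the Euclidean norm with the
sup norm that defines the topology in which paths are continuous. *)
Lemma mx_norm_le_enorm (R : realType) (u : 'rV[R]_2) : `|u| <= enorm u.
Proof.
rewrite [leLHS]mx_normrE; apply: bigmax_le; first exact: enorm_ge0.
by move=> [i j] _ /=; rewrite ord1; exact: coord_le_enorm.
Qed.

(** * Smooth and unit-speed plane curves *)

Lemma derivable_on_coord (R : realType) (a b : R) (f : R -> 'rV[R]_2)
    (i : 'I_2) : (forall t, t \in `[a, b] -> derivable_on a b f t) ->
  has_slope_on a b (fun t => f t 0 i) (fun t => derive_on a b f t 0 i).
Proof.
move=> df t tab.
have ft : diff_quot f t u @[u --> within `[a, b] t^'] --> derive_on a b f t.
  exact: df.
have := cvg_comp _ _ ft (@coord_continuous _ _ _ 0 i _).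
by apply: cvg_trans; apply: near_eq_cvg; near=> u; rewrite /= !mxE.
Unshelve. all: end_near. Qed.

(** Scalar products with a fixed vector reduce vector-valued mean value
arguments to the scalar mean value theorem. *)
Lemma derivable_on_dotp (R : realType) (a b : R) (w : 'rV[R]_2)
    (f : R -> 'rV[R]_2) : (forall t, t \in `[a, b] -> derivable_on a b f t) ->
  has_slope_on a b (fun t => dotp w (f t)) (fun t => dotp w (derive_on a b f t)).
Proof.
move=> df.
have dotpfE (g : R -> 'rV[R]_2) : (fun t => dotp w (g t)) =
    fun t => w 0 0 * g t 0 0 + w 0 1 * g t 0 1.
  by apply/funext => u; rewrite dotpE.
have dcoord i := has_slope_onZ (k := w 0 i) (derivable_on_coord (i := i) df).
by rewrite !dotpfE; exact: has_slope_onD.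
Qed.

Lemma smooth_on_dotp (R : realType) (a b : R) (w : 'rV[R]_2) (n : nat)
    (f : R -> 'rV[R]_2) : smooth_on a b f ->
  has_slope_on a b (fun t => dotp w (derive_on_n a b n f t))
                   (fun t => dotp w (derive_on_n a b n.+1 f t)).
Proof. by move=> sf; apply: derivable_on_dotp => t; exact: sf. Qed.

Lemma smooth_on_coord (R : realType) (a b : R) (i : 'I_2) (n : nat)
    (f : R -> 'rV[R]_2) : smooth_on a b f ->
  has_slope_on a b (fun t => derive_on_n a b n f t 0 i)
                   (fun t => derive_on_n a b n.+1 f t 0 i).
Proof. by move=> sf; apply: derivable_on_coord => t; exact: sf. Qed.

Lemma has_slope_on_dotp_fun (R : realType) (a b : R) (f : R -> 'rV[R]_2)
    (m n : nat) :
  smooth_on a b f ->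
  has_slope_on a b
    (fun t => dotp (derive_on_n a b m f t) (derive_on_n a b n f t))
    (fun t => dotp (derive_on_n a b m.+1 f t) (derive_on_n a b n f t)
            + dotp (derive_on_n a b m f t) (derive_on_n a b n.+1 f t)).
Proof.
move=> sf; have d i k := smooth_on_coord (i := i) (n := k) sf.
have := has_slope_onD (has_slope_onM (d 0 m) (d 0 n)) (has_slope_onM (d 1 m) (d 1 n)).
have dotpfE (g h : R -> 'rV[R]_2) : (fun t => dotp (g t) (h t)) =
    fun t => g t 0 0 * h t 0 0 + g t 0 1 * h t 0 1.
  by apply/funext => u; rewrite dotpE.
rewrite -dotpfE => /has_slope_on_eq; apply => t _; rewrite !dotpE; ring.
Qed.

(** Apply the mean value theorem to the scalar product of the curve with the
chord itself, and bound the result by Cauchy-Schwarz. *)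
Lemma arc_length_lipschitz (R : realType) (a b : R) (f : R -> 'rV[R]_2) :
  smooth_on a b f -> arc_length_param a b f ->
  {in `[a, b] &, forall t u, enorm (f t - f u) <= `|t - u|}.
Proof.
move=> sf uf.
have ordered t u : a <= u -> u < t -> t <= b -> enorm (f t - f u) <= t - u.
  move=> au ut tb; set w := f t - f u.
  have [v] := has_slope_on_MVT au ut tb (smooth_on_dotp (w := w) (n := 0) sf).
  rewrite in_itv/= => /andP[uv vt].
  have vab : v \in `[a, b] by rewrite in_itv/=; apply/andP; split; lra.
  rewrite -dotpBr -/w -enorm_sqr => wE.
  have := dotp_le_enorm w (derive_on a b f v).
  rewrite (uf v vab) mulr1 => wv.
  have [->|w0] := eqVneq (enorm w) 0; first lra.
  have wgt0 : 0 < enorm w by rewrite lt_def w0 enorm_ge0.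
  rewrite -(ler_pM2l wgt0) -expr2 wE.
  by apply: ler_wpM2r => //; lra.
move=> t u; rewrite !in_itv/= => /andP[at_ tb] /andP[au ub].
have [tu|ut|->] := ltgtP t u.
- by rewrite enorm_distC distrC gtr0_norm ?subr_gt0//; apply: ordered.
- by rewrite gtr0_norm ?subr_gt0//; apply: ordered.
- by rewrite subrr enorm0.
Qed.

(** A short arc is almost as long as its chord: projected onto the tangent at
[c], the curve moves at a speed close to 1 near [c]. *)
Lemma arc_length_local_expansion (R : realType) (a b : R) (f : R -> 'rV[R]_2)
    (c e : R) : smooth_on a b f -> arc_length_param a b f -> c \in `[a, b] ->
  0 < e -> \forall d \near 0^'+, {in `[a, b] &, forall t u,
    `|t - c| < d -> `|u - c| < d -> `|t - u| <= (1 + e) * enorm (f t - f u)}.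
Proof.
move=> sf uf cab e0; set w := derive_on a b f c.
have w1 : enorm w = 1 by exact: uf.
have cw : dotp w (derive_on a b f t) @[t --> within `[a, b] (nbhs c)] --> (1 : R).
  have := has_slope_on_continuous (smooth_on_dotp (w := w) (n := 1) sf).
  move=> /subspace_continuousP/(_ c cab).
  have -> : (1 : R) = dotp w w by rewrite -enorm_sqr w1 expr1n.
  exact.
(* Tangential speed above [(1 + e)^-1] makes arcs at most [1 + e] times as long
as chords. *)
have e1 : 0 < 1 - (1 + e)^-1 by rewrite subr_gt0 invf_lt1; lra.
have /cvgrPdist_lt/(_ _ e1) := cw.
rewrite near_withinE => /nbhs_ballP[r /= r0 near_c].
near=> d.
have dr : d < r by near: d; exact: nbhs_right_lt.
have ordered t u : t \in `[a, b] -> u \in `[a, b] -> u < t ->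
    `|t - c| < d -> `|u - c| < d -> t - u <= (1 + e) * enorm (f t - f u).
  rewrite !in_itv/= => /andP[at_ tb] /andP[au ub] ut tc uc.
  have [v] := has_slope_on_MVT au ut tb (smooth_on_dotp (w := w) (n := 0) sf).
  rewrite in_itv/= -dotpBr => /andP[uv vt] wE.
  have vab : v \in `[a, b] by rewrite in_itv/=; apply/andP; split; lra.
  have vc : `|c - v| < r.
    move: tc uc; rewrite ![`|_ - c| < d]ltr_distl => /andP[? ?] /andP[? ?].
    by rewrite ltr_distl; apply/andP; split; lra.
  have := near_c v vc vab; rewrite /= ltr_distl => /andP[_].
  rewrite addrCA ltrDl subr_gt0 => /ltW wv.
  have := dotp_le_enorm w (f t - f u); rewrite w1 mul1r wE => le_w.
  rewrite -ler_pdivrMl; last by rewrite addr_gt0.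
  apply: le_trans le_w; apply: ler_wpM2r; last exact: wv.
  by rewrite subr_ge0 ltW.
move=> t u tab uab tc uc; have [tu|ut|->] := ltgtP t u.
- by rewrite enorm_distC distrC gtr0_norm ?subr_gt0//; apply: ordered.
- by rewrite gtr0_norm ?subr_gt0//; apply: ordered.
- by rewrite !subrr normr0 enorm0 mulr0.
Unshelve. all: end_near. Qed.

(** Differentiate [|f'|^2 = 1] twice. *)
Lemma arc_length_third_derivative (R : realType) (a b : R) (f : R -> 'rV[R]_2) :
  a < b -> smooth_on a b f -> arc_length_param a b f -> {in `[a, b], forall t,
    dotp (derive_on_n a b 1 f t) (derive_on_n a b 3 f t) =
    - dotp (derive_on_n a b 2 f t) (derive_on_n a b 2 f t)}.
Proof.
move=> ab sf uf.
have speed : {in `[a, b], forall t,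
    dotp (derive_on_n a b 1 f t) (derive_on_n a b 1 f t) = 1}.
  by move=> t tab; rewrite -enorm_sqr (uf t tab) expr1n.
have ortho : {in `[a, b], forall t,
    dotp (derive_on_n a b 1 f t) (derive_on_n a b 2 f t) = 0}.
  move=> t tab; have d11 := has_slope_on_dotp_fun (m := 1%N) (n := 1%N) sf.
  have := has_slope_on_constant ab d11 speed tab.
  have dotpC (u v : 'rV[R]_2) : dotp u v = dotp v u by rewrite !dotpE; ring.
  by rewrite [X in X + _]dotpC => h; lra.
move=> t tab; have d12 := has_slope_on_dotp_fun (m := 1%N) (n := 2%N) sf.
have := has_slope_on_constant ab d12 ortho tab.
by move=> h; apply/eqP; rewrite -addr_eq0 addrC h.
Qed.

(** * Lengths and geodesic distance *)

(** [phi] induces a function on the trace of [f]; its local constancy near the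
parameters of a multiple point controls that function along chords joining two
branches there, which may be tangent or even form a cusp. *)
Definition compatible_with (R : realType) (a b : R) (f : R -> 'rV[R]_2)
    (phi : R -> R) : Prop :=
  forall t u : R, t \in `[a, b] -> u \in `[a, b] -> t != u -> f t = f u ->
  exists k, forall v, v = t \/ v = u ->
    \forall v' \near v, v' \in `[a, b] -> phi v' = k.

Lemma compatible_with_eq (R : realType) (a b : R) (f : R -> 'rV[R]_2)
    (phi : R -> R) : compatible_with a b f phi ->
  {in `[a, b] &, forall t u, f t = f u -> phi t = phi u}.
Proof.
move=> fphi t u tab uab ftu; have [->//|tu] := eqVneq t u.
have [k phik] := fphi t u tab uab tu ftu.
by rewrite (nbhs_singleton (phik t _))// ?(nbhs_singleton (phik u _))//; [right|left].
Qed.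

(** The bound is local in the pair of parameters, and compactness of the square
makes [d] uniform.  Near a pair of parameters of distinct points no chord is
shorter than some [d]; on the diagonal chords and arcs are comparable; near the
two parameters of a multiple point [phi] is constant. *)
Lemma arc_length_chord_bound (R : realType) (a b e : R) (f : R -> 'rV[R]_2)
    (phi : R -> R) : smooth_on a b f -> arc_length_param a b f ->
  {in `[a, b] &, forall t u, `|phi t - phi u| <= `|t - u|} ->
  compatible_with a b f phi -> 0 < e ->
  exists2 d, 0 < d & {in `[a, b] &, forall t u, enorm (f t - f u) < d ->
    `|phi t - phi u| <= (1 + e) * enorm (f t - f u)}.
Proof.
move=> sf uf lphi cphi e0.
have /compact_near_coveringP/near_covering_withinP cover :
    compact (`[a, b]%classic `*` `[a, b]%classic).
  by apply: compact_setX; exact: segment_compact.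
pose P (d : R) (p : R * R) := enorm (f p.1 - f p.2) < d ->
  `|phi p.1 - phi p.2| <= (1 + e) * enorm (f p.1 - f p.2).
suff near_P : \forall d \near 0^'+, (`[a, b]%classic `*` `[a, b]%classic) `<=` P d.
  have [d [d0 Pd]] : exists d : R, 0 < d /\ (`[a, b]%classic `*` `[a, b]%classic) `<=` P d.
    near (0:R)^'+ => d; exists d; split; first by [].
    by near: d.
  exists d => // t u tab uab ftu; exact: (Pd (t, u)).
apply: cover => -[t u] [/= tab uab].
(* It suffices to bound [phi] on a product of neighborhoods of [t] and [u]. *)
have box (U V D : set R) : nbhs t U -> nbhs u V -> (0 : R)^'+ D ->
    (forall t' u' d, U t' -> V u' -> D d -> t' \in `[a, b] -> u' \in `[a, b] ->
      P d (t', u')) ->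
    \forall p \near (t, u) & d \near 0^'+,
      (`[a, b]%classic `*` `[a, b]%classic) p -> P d p.
  move=> Ut Vu D0 UVD; exists (U `*` V, D); first by split => //; exists (U, V).
  move=> [[t' u'] d] [[/= Ut' Vu'] Dd] [/= tab' uab']; exact: UVD.
have [ftu|ftu] := eqVneq (f t) (f u); last first.
  have [i fi] : exists i, f t 0 i != f u 0 i.
    apply: contrapT => /forallNP fE; case/eqP: ftu; apply/rowP => i.
    by have /negP := fE i; rewrite negbK => /eqP.
  have [h hE] : exists h : R, h = `|f t 0 i - f u 0 i| by eexists.
  have h0 : 0 < h by rewrite hE normr_gt0 subr_eq0.
  have cf := derivable_on_coord (i := i) (sf 0%N).
  have near_f v : v \in `[a, b] -> \forall v' \near v, v' \in `[a, b] ->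
      `|f v 0 i - f v' 0 i| < h / 4.
    move=> vab; have := has_slope_on_continuous cf.
    move=> /subspace_continuousP/(_ v vab)/cvgrPdist_lt/(_ (h / 4)).
    by rewrite near_withinE; apply; lra.
  have h2 : 0 < h / 2 by rewrite divr_gt0.
  apply: (box _ _ _ (near_f t tab) (near_f u uab) (nbhs_right_lt h2)).
  move=> t' u' d /= near_t near_u dh tab' uab' fd.
  have : `|f t' 0 i - f u' 0 i| < d.
    by have := coord_le_enorm (f t' - f u') i; rewrite !mxE => /le_lt_trans; apply.
  have := ler_distD (f t' 0 i) (f t 0 i) (f u 0 i).
  have := ler_distD (f u' 0 i) (f t' 0 i) (f u 0 i).
  rewrite -hE [`|f u' 0 i - _|]distrC; have := near_u uab'; have := near_t tab'.
  lra.
have [tu|tu] := eqVneq t u.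
  have [r [r0 fr]] : exists r : R, 0 < r /\ {in `[a, b] &, forall v w,
      `|v - t| < r -> `|w - t| < r -> `|v - w| <= (1 + e) * enorm (f v - f w)}.
    near (0 : R)^'+ => r; exists r; split; first by [].
    by near: r; exact: arc_length_local_expansion.
  have near_ball : nbhs t [set v | `|v - t| < r].
    by apply/nbhs_ballP; exists r => //= v; rewrite /ball/= distrC.
  have near_ball' : nbhs u [set v | `|v - t| < r] by rewrite -tu.
  apply: (box _ _ setT near_ball near_ball' filterT).
  move=> t' u' d /= tr ur _ tab' uab' _.
  by apply: le_trans (lphi _ _ tab' uab') _; exact: fr.
have [k phik] := cphi t u tab uab tu ftu.
apply: (box _ _ setT (phik t _) (phik u _) filterT); [by left|by right|].
move=> t' u' d /= tk uk _ tab' uab' _.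
by rewrite /P/= tk// uk// subrr normr0 mulr_ge0 ?enorm_ge0// addr_ge0// ltW.
Unshelve. all: end_near. Qed.

(** Heine's theorem, for the Euclidean norm. *)
Lemma path_uniformly_continuous (R : realType) (sigma : R -> 'rV[R]_2) (e : R) :
  {within `[0, 1], continuous sigma} -> 0 < e ->
  exists2 d, 0 < d & {in `[0, 1] &, forall u v,
    `|u - v| < d -> enorm (sigma u - sigma v) < e}.
Proof.
move=> csigma e0.
have /compact_near_coveringP/near_covering_withinP cover :
  compact `[0 : R, 1]%classic by exact: segment_compact.
pose P (d u : R) := {in `[0, 1], forall v,
  `|u - v| < d -> enorm (sigma u - sigma v) < e}.
suff near_P : \forall d \near 0^'+, `[0, 1]%classic `<=` P d.
  have [d [d0 Pd]] : exists d : R, 0 < d /\ `[0, 1]%classic `<=` P d.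
    near (0 : R)^'+ => d; exists d; split; first by [].
    by near: d.
  by exists d => // u v uI vI; exact: Pd.
apply: cover => w wI.
(* Two steps of size [e / 8], doubled by the comparison of norms, stay below [e]. *)
have e8 : 0 < e / 8 by rewrite divr_gt0.
have /subspace_continuousP/(_ w wI)/cvgrPdist_lt/(_ _ e8) := csigma.
rewrite near_withinE => /nbhs_ballP[r /= r0 near_w].
have r2 : 0 < r / 2 by rewrite divr_gt0.
have near_ball : nbhs w [set v | `|v - w| < r / 2].
  by apply/nbhs_ballP; exists (r / 2) => //= v; rewrite /ball/= distrC.
exists ([set v | `|v - w| < r / 2], [set d | d < r / 2]).
  by split => //; exact: nbhs_right_lt.
move=> [u d] [/= uw dr] uI v vI uv.
have wu : `|w - u| < r by rewrite distrC; lra.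
have wv : `|w - v| < r by have := ler_distD u w v; rewrite [`|w - u|]distrC; lra.
have su := near_w u wu uI; have sv := near_w v wv vI.
have small i : `|(sigma u - sigma v) 0 i| <= e / 4.
  have coord_le (M : 'rV[R]_2) : `|M 0 i| <= `|M|.
    rewrite [leRHS]mx_normrE.
    exact: (le_bigmax _ (fun ij => `|M ij.1 ij.2|) (0, i)).
  have := coord_le (sigma w - sigma u); have := coord_le (sigma w - sigma v).
  have := ler_distD (sigma w 0 i) (sigma u 0 i) (sigma v 0 i).
  rewrite !mxE [`|sigma u 0 i - sigma w 0 i|]distrC; lra.
by apply: le_lt_trans (enorm_le_coord small) _; lra.
Unshelve. all: end_near. Qed.

Definition uniform_partition (R : realType) (N : nat) : seq R :=
  [seq k%:R / N%:R | k <- iota 1 N].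

Lemma uniform_partitionP (R : realType) (N : nat) : (0 < N)%N ->
  itv_partition 0 1 (uniform_partition R N).
Proof.
move=> N0; have NR0 : 0 < N%:R :> R by rewrite ltr0n.
have frac0 : 0 = 0%:R / N%:R :> R by rewrite mul0r.
rewrite /uniform_partition; split.
  rewrite {1}frac0.
  apply: (@homo_path _ _ (fun k : nat => k%:R / N%:R) ltn).
    by move=> i j ij; rewrite ltr_pM2r ?invr_gt0// ltr_nat.
  exact: (iota_ltn_sorted 0 N.+1).
rewrite -nth_last size_map size_iota (nth_map 0%N) ?size_iota ?prednK//.
rewrite nth_iota ?prednK// add1n prednK//.
by rewrite divff ?eqxx ?gt_eqF.
Qed.

Lemma nth_uniform_partition (R : realType) (N k : nat) : (k <= N)%N ->
  nth 0 (0 :: uniform_partition R N) k = k%:R / N%:R.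
Proof.
case: k => [|k] kN /=; first by rewrite mul0r.
by rewrite (nth_map 0%N) ?size_iota// nth_iota.
Qed.

(** A function that is [C]-Lipschitz for short steps of the path only: steps of a
fine enough subdivision are short by uniform continuity, and the increments of
[h] telescope. *)
Lemma polygonal_length_ge (R : realType) (sigma : R -> 'rV[R]_2) (h : R -> R)
    (d C : R) : {within `[0, 1], continuous sigma} -> 0 < d ->
  {in `[0, 1] &, forall u v, enorm (sigma u - sigma v) < d ->
    `|h u - h v| <= C * enorm (sigma u - sigma v)} ->
  exists2 p, itv_partition 0 1 p & h 1 - h 0 <= C * polygonal_length 0 sigma p.
Proof.
move=> csigma d0 hC.
have [r r0 fine] := path_uniformly_continuous csigma d0.
have [N N0 mesh] : exists2 N, (0 < N)%N & N%:R^-1 < r.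
  exists (Num.truncn r^-1).+1 => //.
  by rewrite invf_plt ?posrE//; exact: truncnS_gt.
have NR0 : 0 < N%:R :> R by rewrite ltr0n.
exists (uniform_partition R N); first exact: uniform_partitionP.
have -> : h 1 - h 0 = \sum_(0 <= k < N) (h (k.+1%:R / N%:R) - h (k%:R / N%:R)).
  by rewrite (telescope_sumr (fun k => h (k%:R / N%:R)))// mul0r divff ?gt_eqF.
rewrite /polygonal_length size_map size_iota mulr_sumr.
rewrite !big_nat; apply: ler_sum => k kN; have {}kN : (k < N)%N by [].
rewrite (nth_uniform_partition R kN) (nth_uniform_partition R (ltnW kN)).
have inI j : (j <= N)%N -> j%:R / N%:R \in `[0 : R, 1].
  by move=> jN; rewrite in_itv/= divr_ge0 ?ler0n//= ler_pdivrMr// mul1r ler_nat.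
have step : `|k.+1%:R / N%:R - k%:R / N%:R| < r.
  by rewrite -mulrBl -natrB// subSnn mul1r gtr0_norm ?invr_gt0.
apply: le_trans (ler_norm _) _.
by apply: hC; rewrite ?inI ?(ltnW kN)//; apply: fine; rewrite ?inI ?(ltnW kN).
Qed.

Lemma curve_length_le_lipschitz (R : realType) (a b k : R)
    (sigma : R -> 'rV[R]_2) :
  {in `[a, b] &, forall t u, u <= t -> enorm (sigma t - sigma u) <= k * (t - u)} ->
  (curve_length a b sigma <= (k * (b - a))%:E)%E.
Proof.
move=> lip; apply: ge_ereal_sup => _ [p pab <-]; rewrite lee_fin.
have inab m : (m <= size p)%N -> nth a (a :: p) m \in `[a, b].
  move=> mp; rewrite in_itv/= (set_nth_default b)//.
  by rewrite (itv_partition_nth_ge _ pab)// (itv_partition_nth_le _ pab).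
have incr m : (m < size p)%N -> nth a (a :: p) m <= nth a (a :: p) m.+1.
  by move=> mp; case: pab => /(pathP a)/(_ m mp)/ltW.
have -> : b - a = \sum_(0 <= m < size p) (nth a (a :: p) m.+1 - nth a (a :: p) m).
  rewrite (telescope_sumr (fun m => nth a (a :: p) m))//; congr (_ - _).
  by rewrite (set_nth_default b)// (itv_partition_nth_size b pab).
rewrite /polygonal_length mulr_sumr !big_nat; apply: ler_sum => m mp.
have {}mp : (m < size p)%N by [].
by apply: lip; [exact: inab|exact/inab/ltnW|exact: incr].
Qed.

Lemma geodesic_dist_le_arc_length (R : realType) (S s : R) (f : R -> 'rV[R]_2) :
  smooth_on 0 S f -> arc_length_param 0 S f -> s \in `[0, S] ->
  (geodesic_dist [set f t | t in `[0%R, S]] (f 0%R) (f s) <= s%:E)%E.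
Proof.
move=> sf uf sS; have [s0 sleS] : 0 <= s /\ s <= S by move: sS; rewrite in_itv/= => /andP.
have inS u : u \in `[0, 1] -> s * u \in `[0, S].
  rewrite !in_itv/= => /andP[u0 u1]; rewrite mulr_ge0//=.
  by apply: le_trans sleS; rewrite ler_piMr.
pose sigma u := f (s * u).
have lip : {in `[0, 1] &, forall t u, enorm (sigma t - sigma u) <= s * `|t - u|}.
  move=> t u tI uI; rewrite -[s in s * _](ger0_norm s0) -normrM mulrBr.
  exact: (arc_length_lipschitz sf uf (inS _ tI) (inS _ uI)).
apply: (@le_trans _ _ (curve_length 0 1 sigma)).
  apply: ereal_inf_lbound; exists sigma => //; split.
  - apply/subspace_continuousP => u uI; apply/cvgrPdist_le => e e0.
    rewrite near_withinE.
    have s1 : 0 < s + 1 by rewrite ltr_wpDl.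
    apply/nbhs_ballP; exists (e / (s + 1)) => /=; first by rewrite divr_gt0.
    move=> v uv vI; apply: le_trans (mx_norm_le_enorm _) _.
    apply: le_trans (lip u v uI vI) _.
    have /ltW := uv; rewrite ler_pdivlMr// mulrC mulrDl mul1r; apply: le_trans.
    by rewrite lerDl.
  - by move=> t tI; exists (s * t) => //; exact: inS.
  - by rewrite /sigma mulr0.
  - by rewrite /sigma mulr1.
have := @curve_length_le_lipschitz R 0 1 s sigma; rewrite subr0 mulr1; apply.
move=> t u tI uI ut; rewrite -(@ger0_norm _ (t - u)) ?subr_ge0//; exact: lip.
Qed.

(** A path in the trace of [f] lifts to a function [tau] of parameters, which is
in general discontinuous; only [phi \o tau] matters, and it does not depend on
the choice of the lift. *)
Lemma arc_length_le_geodesic_dist (R : realType) (S s : R) (f : R -> 'rV[R]_2) :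
  smooth_on 0 S f -> arc_length_param 0 S f -> s \in `[0, S] ->
  (forall e, 0 < e -> exists phi : R -> R,
    [/\ {in `[0, S] &, forall t u, `|phi t - phi u| <= `|t - u|},
        compatible_with 0 S f phi & s - e <= phi s - phi 0]) ->
  (s%:E <= geodesic_dist [set f t | t in `[0%R, S]] (f 0%R) (f s))%E.
Proof.
move=> sf uf sS hphi; have [s0 sleS] : 0 <= s /\ s <= S.
  by move: sS; rewrite in_itv/= => /andP.
apply: le_ereal_inf_tmp => _ [sigma [csigma sigmaM sigma0 sigma1] <-].
apply/lee_addgt0Pr => e e0.
have e2 : 0 < e / 2 by rewrite divr_gt0.
have [phi [lphi cphi phis]] := hphi _ e2.
(* With this [eta], the factor [1 + eta] costs at most [e / 2] on a length that
does not exceed [s]; the other [e / 2] is lost by [phi]. *)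
pose eta := e / 2 / (s + 1).
have s1 : 0 < s + 1 by rewrite ltr_wpDl.
have eta0 : 0 < eta by rewrite divr_gt0.
have etas : eta * s <= e / 2.
  have <- : eta * (s + 1) = e / 2 by rewrite /eta divfK// gt_eqF.
  by apply: ler_wpM2l; rewrite ?ltW// ltrDl.
have [d d0 chord] := arc_length_chord_bound sf uf lphi cphi eta0.
have [tau tauP] : exists tau : R -> R, forall u, u \in `[0, 1] ->
    tau u \in `[0, S] /\ f (tau u) = sigma u.
  have /choice[tau tauP] u : exists t, u \in `[0, 1] -> t \in `[0, S] /\ f t = sigma u.
    have [/sigmaM[t tS ft]|uI] := boolP (u \in `[0, 1]); first by exists t.
    by exists 0.
  by exists tau.
have S00 : 0 \in `[0, S] by rewrite in_itv/= lexx (le_trans s0).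
have I0 : (0 : R) \in `[0, 1] by rewrite in_itv/= lexx ler01.
have I1 : (1 : R) \in `[0, 1] by rewrite in_itv/= lexx ler01.
have chord_tau : {in `[0, 1] &, forall u v, enorm (sigma u - sigma v) < d ->
    `|(phi \o tau) u - (phi \o tau) v| <= (1 + eta) * enorm (sigma u - sigma v)}.
  move=> u v uI vI; have [tu <-] := tauP u uI; have [tv <-] := tauP v vI.
  exact: chord.
have [p pP hp] := polygonal_length_ge csigma d0 chord_tau.
have phi0 : phi (tau 0) = phi 0.
  have [t0 ft0] := tauP 0 I0.
  by apply: (compatible_with_eq cphi) => //; rewrite ft0.
have phi1 : phi (tau 1) = phi s.
  have [t1 ft1] := tauP 1 I1.
  by apply: (compatible_with_eq cphi) => //; rewrite ft1.
have pL : ((polygonal_length 0 sigma p)%:E <= curve_length 0 1 sigma)%E.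
  by apply: ereal_sup_ubound; exists p.
apply: (@le_trans _ _ ((polygonal_length 0 sigma p)%:E + e%:E)%E); last exact: leeD2r.
rewrite -EFinD lee_fin.
move: hp; rewrite /= phi0 phi1 => hp.
have [pls|/ltW slp] := leP (polygonal_length 0 sigma p) s; last first.
  by apply: le_trans slp _; rewrite lerDl ltW.
have : eta * polygonal_length 0 sigma p <= eta * s by apply: ler_wpM2l => //; exact: ltW.
move: hp phis etas; rewrite mulrDl mul1r.
set L := polygonal_length 0 sigma p; lra.
Qed.

Lemma geodesic_dist_injective (R : realType) (S s : R) (f : R -> 'rV[R]_2) :
  smooth_on 0 S f -> arc_length_param 0 S f ->
  {in `[0, S] &, injective f} -> s \in `[0, S] ->
  geodesic_dist [set f t | t in `[0, S]] (f 0) (f s) = s%:E.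
Proof.
move=> sf uf injf sS; apply/eqP; rewrite eq_le geodesic_dist_le_arc_length//=.
apply: arc_length_le_geodesic_dist => // e e0; exists id; split => //.
  by move=> t u tS uS /eqP tu /(injf _ _ tS uS).
by rewrite subr0 lerBlDr lerDl ltW.
Qed.

Lemma dist_min_le (R : realDomainType) (x y x' y' d : R) :
  `|x - x'| <= d -> `|y - y'| <= d -> `|Num.min x y - Num.min x' y'| <= d.
Proof.
rewrite !ler_distl => /andP[? ?] /andP[? ?].
by have [?|?] := leP x y; have [?|?] := leP x' y'; apply/andP; split; lra.
Qed.

Lemma dist_max_le (R : realDomainType) (x y x' y' d : R) :
  `|x - x'| <= d -> `|y - y'| <= d -> `|Num.max x y - Num.max x' y'| <= d.
Proof.
rewrite !ler_distl => /andP[? ?] /andP[? ?].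
by have [?|?] := leP x y; have [?|?] := leP x' y'; apply/andP; split; lra.
Qed.

Lemma compatible_with_endpoint (R : realType) (S : R) (f : R -> 'rV[R]_2)
    (phi : R -> R) : {in `[0, S[ &, injective f} ->
  (forall t, t \in `[0, S[ -> f t = f S -> exists k, forall v, v = t \/ v = S ->
    \forall v' \near v, v' \in `[0, S] -> phi v' = k) ->
  compatible_with 0 S f phi.
Proof.
move=> injf end_f t u tS uS tu ftu.
have lt_or_S v : v \in `[0, S] -> v = S \/ v \in `[0, S[.
  have [->|vS] := eqVneq v S; first by left.
  by rewrite !in_itv/= lt_neqAle vS => /andP[-> ->]; right.
have [tE|tS'] := lt_or_S t tS; have [uE|uS'] := lt_or_S u uS.
- by move: tu; rewrite tE uE eqxx.
- have [|k kP] := end_f u uS'; first by rewrite -ftu tE.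
  by exists k => v vE; apply: kP; case: vE => ->; [right|left].
- have [|k kP] := end_f t tS'; first by rewrite ftu uE.
  by exists k => v vE; apply: kP; case: vE => ->; [left|right].
- by case/eqP: tu; apply: injf.
Qed.

(** Injectivity on the half-open segment leaves one possible coincidence, between
[f S] and some [f t].  When [t > 0] it lies beyond [s] for small [s], and
truncating the parameter at [s] ignores it.  When [t = 0] the curve is closed,
and the shorter way around to [f s] is the initial arc as soon as
[s < S / 2]. *)
Lemma geodesic_dist_near (R : realType) (S : R) (f : R -> 'rV[R]_2) :
  0 < S -> smooth_on 0 S f -> arc_length_param 0 S f ->
  {in `[0, S[ &, injective f} ->
  \forall s \near (0 : R)^'+,
    geodesic_dist [set f t | t in `[0, S]] (f 0) (f s) = s%:E.
Proof.
move=> S0 sf uf injf.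
have S00 : 0 \in `[0, S[ by rewrite in_itv/= lexx.
have [f0S|f0S] := eqVneq (f 0) (f S).
  near=> s.
  have s0 : 0 < s by [].
  have sS2 : s < S / 2 by near: s; apply: nbhs_right_lt; rewrite divr_gt0.
  have sS : s \in `[0, S] by rewrite in_itv/=; apply/andP; split; lra.
  apply/eqP; rewrite eq_le geodesic_dist_le_arc_length//=.
  apply: arc_length_le_geodesic_dist => // e e0.
  (* The distance to the common point along the shorter branch, truncated at [s];
  the shift by [e] makes it vanish near both parameters of that point. *)
  exists (fun t => Num.max 0 (Num.min (Num.min t (S - t)) s - e)); split.
  - move=> t u tS uS; apply: dist_max_le; first by rewrite subrr normr0.
    rewrite [X in `|X|](_ : _ = Num.min (Num.min t (S - t)) s -
      Num.min (Num.min u (S - u)) s); last by ring.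
    apply: dist_min_le; last by rewrite subrr normr0.
    apply: dist_min_le => //.
    by rewrite [X in `|X|](_ : _ = u - t) 1?distrC//; ring.
  - apply: compatible_with_endpoint => // t tS ftS.
    have {}tS : t = 0 by apply: injf => //; rewrite ftS.
    exists 0 => v vE.
    have near_v : \forall v' \near v, `|v - v'| < e by apply/nbhs_ballP; exists e.
    apply: filterS near_v => v'; rewrite ltr_distl => /andP[vv' v'v] v'S.
    apply: max_l; rewrite subr_le0 ge_min; apply/orP; left; rewrite ge_min.
    by apply/orP; case: vE => vE; [left|right]; lra.
  - rewrite (_ : Num.min (Num.min s (S - s)) s = s); last first.
      by rewrite (min_idPl (_ : s <= S - s)) ?minxx//; lra.
    rewrite (_ : Num.min (Num.min 0 (S - 0)) s = 0); last first.
      by rewrite subr0 (min_idPl (ltW S0)) (min_idPl (ltW s0)).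
    by rewrite sub0r (@max_l _ _ 0 (- e)) ?subr0 ?le_max ?lexx ?orbT// lerNl oppr0 ltW.
have [r r0 rP] : exists2 r, 0 < r & forall t, t \in `[0, S[ -> f t = f S -> r <= t.
  have [[t tS ftS]|noend] := pselect (exists2 t, t \in `[0, S[ & f t = f S); last first.
    by exists 1 => // t tS ftS; case: noend; exists t.
  exists t.
    move: tS; rewrite in_itv/= le_eqVlt => /andP[/orP[/eqP t0|//] _].
    by case/eqP: f0S; rewrite t0.
  by move=> u uS fuS; rewrite (injf u t)// fuS.
near=> s.
have s0 : 0 < s by [].
have sr : s < r by near: s; exact: nbhs_right_lt.
have sltS : s < S by near: s; exact: nbhs_right_lt.
have sS : s \in `[0, S] by rewrite in_itv/= !ltW.
apply/eqP; rewrite eq_le geodesic_dist_le_arc_length//=.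
apply: arc_length_le_geodesic_dist => // e e0.
(* Constant beyond [s], hence near the two parameters of a double point, which
are both at least [r]. *)
exists (fun t => Num.min t s); split.
- by move=> t u tS uS; apply: dist_min_le => //; rewrite subrr normr0.
- apply: compatible_with_endpoint => // t tS ftS; exists s => v vE.
  have sv : s < v by case: vE => ->//; apply: lt_le_trans sr _; exact: rP.
  apply: filterS (lt_nbhsr sv) => v' sv' _; exact/min_idPr/ltW.
- by rewrite minxx (min_idPl (ltW s0)) subr0 lerBlDr lerDl ltW.
Unshelve. all: end_near. Qed.

(** * The osculating circle *)

(** Read off the difference quotient at 0, so that no bound on the derivative
near 0 enters; this starts the chain of integrations by [bigO_primitive]. *)
Lemma has_slope_on_bigO (R : realType) (S : R) (F F' : R -> R) :
  0 < S -> has_slope_on 0 S F F' -> F 0 = 0 ->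
  F =O_ ((0 : R)^'+) (fun s => s ^+ 1).
Proof.
move=> S0 FF' F0; apply/eqO_exP; exists (`|F' 0| + 1); first by rewrite ltr_wpDl.
have S00 : 0 \in `[0, S] by rewrite in_itv/= lexx ltW.
have /cvgrPdist_lt/(_ 1 ltr01) := FF' 0 S00.
rewrite F0 near_withinE /dnbhs near_withinE => near_0.
rewrite near_withinE; apply: filterS2 near_0 (lt_nbhsl S0) => s F's sS s0.
have sI : s \in `[0, S] by rewrite in_itv/= !ltW.
have {F's} := F's (lt0r_neq0 s0) sI; rewrite !subr0 => F's.
rewrite expr1 -ler_pdivrMr ?normr_gt0 ?gt_eqF// -normfV -normrM mulrC.
by have := ler_distD (F' 0) (s^-1 * F s) 0; rewrite !subr0 distrC; lra.
Qed.

(** [A k] and [B k] stand for the [k]-th derivatives of the tangential and normal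
coordinates.  The quantity estimated is, up to the factor [kappa], the
numerator of the derivative of [theta - kappa s], where [theta] is the angle
subtended at the center of curvature. *)
Lemma osculating_defect_bigO (R : realType) (S kappa : R) (A B : nat -> R -> R) :
  0 < S ->
  (forall k, has_slope_on 0 S (A k) (A k.+1)) ->
  (forall k, has_slope_on 0 S (B k) (B k.+1)) ->
  A 0%N 0 = 0 -> A 1%N 0 = 1 -> A 2%N 0 = 0 -> A 3%N 0 = - kappa ^+ 2 ->
  B 0%N 0 = 0 -> B 1%N 0 = 0 -> B 2%N 0 = kappa ->
  (fun t => A 1%N t * (1 - kappa * B 0%N t) + kappa * (A 0%N t * B 1%N t)
    - ((1 - kappa * B 0%N t) * (1 - kappa * B 0%N t)
       + kappa ^+ 2 * (A 0%N t * A 0%N t)))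
    =O_ ((0 : R)^'+) (fun s => s ^+ 3).
Proof.
move=> S0 dA dB A0 A1 A2 A3 B0 B1 B2.
pose N t := A 1%N t * (1 - kappa * B 0%N t) + kappa * (A 0%N t * B 1%N t)
  - ((1 - kappa * B 0%N t) * (1 - kappa * B 0%N t)
     + kappa ^+ 2 * (A 0%N t * A 0%N t)).
suff : N =O_ ((0 : R)^'+) (fun s => s ^+ 3) by [].
pose p t := 1 - kappa * B 0%N t.
pose N1 t := A 2%N t * p t + kappa * (A 0%N t * B 2%N t)
  + 2 * kappa * (B 1%N t * p t) - 2 * kappa ^+ 2 * (A 0%N t * A 1%N t).
pose N2 t := A 3%N t * p t - kappa * (A 2%N t * B 1%N t)
  + kappa * (A 1%N t * B 2%N t + A 0%N t * B 3%N t)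
  + 2 * kappa * (B 2%N t * p t - kappa * (B 1%N t * B 1%N t))
  - 2 * kappa ^+ 2 * (A 1%N t * A 1%N t + A 0%N t * A 2%N t).
have dp : has_slope_on 0 S p (fun t => 0 - kappa * B 1%N t).
  exact: (has_slope_onB (@has_slope_on_cst R 0 S 1) (has_slope_onZ (k := kappa) (dB 0%N))).
have dN : has_slope_on 0 S N N1.
  have := has_slope_onB
    (has_slope_onD (has_slope_onM (dA 1%N) dp)
       (has_slope_onZ (k := kappa) (has_slope_onM (dA 0%N) (dB 1%N))))
    (has_slope_onD (has_slope_onM dp dp)
       (has_slope_onZ (k := kappa ^+ 2) (has_slope_onM (dA 0%N) (dA 0%N)))).
  move/has_slope_on_eq; apply => t _; rewrite /N1 /p; ring.
have dN1 : has_slope_on 0 S N1 N2.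
  have := has_slope_onB
    (has_slope_onD
      (has_slope_onD (has_slope_onM (dA 2%N) dp)
       (has_slope_onZ (k := kappa) (has_slope_onM (dA 0%N) (dB 2%N))))
      (has_slope_onZ (k := 2 * kappa) (has_slope_onM (dB 1%N) dp)))
    (has_slope_onZ (k := 2 * kappa ^+ 2) (has_slope_onM (dA 0%N) (dA 1%N))).
  move/has_slope_on_eq; apply => t _; rewrite /N2 /p; ring.
have [N3 dN2] : exists N3, has_slope_on 0 S N2 N3.
  eexists.
  exact: (has_slope_onB
    (has_slope_onD
      (has_slope_onD
        (has_slope_onB (has_slope_onM (dA 3%N) dp)
          (has_slope_onZ (k := kappa) (has_slope_onM (dA 2%N) (dB 1%N))))
        (has_slope_onZ (k := kappa)
          (has_slope_onD (has_slope_onM (dA 1%N) (dB 2%N))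
             (has_slope_onM (dA 0%N) (dB 3%N)))))
      (has_slope_onZ (k := 2 * kappa)
        (has_slope_onB (has_slope_onM (dB 2%N) dp)
          (has_slope_onZ (k := kappa) (has_slope_onM (dB 1%N) (dB 1%N))))))
    (has_slope_onZ (k := 2 * kappa ^+ 2)
      (has_slope_onD (has_slope_onM (dA 1%N) (dA 1%N))
         (has_slope_onM (dA 0%N) (dA 2%N))))).
have N0 : N 0 = 0 by rewrite /N A0 A1 B0; ring.
have N10 : N1 0 = 0 by rewrite /N1 /p A0 A2 B0 B1; ring.
have N20 : N2 0 = 0 by rewrite /N2 /p A0 A1 A2 A3 B0 B1 B2; ring.
have N2O := has_slope_on_bigO S0 dN2 N20.
have N1O : N1 =O_ ((0 : R)^'+) (fun s => s ^+ 2).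
  apply: (bigO_primitive S0 _ _ N10 N2O); first exact: has_slope_on_continuous dN1.
  by move=> s sS; exact: has_slope_on_is_derive dN1 sS.
apply: (bigO_primitive S0 _ _ N0 N1O); first exact: has_slope_on_continuous dN.
by move=> s sS; exact: has_slope_on_is_derive dN sS.
Qed.

(** The derivative of the left-hand side is [kappa N / D] with [N = O(s^3)] by
[osculating_defect_bigO] and [D] bounded below near 0. *)
Lemma osculating_angle_bigO (R : realType) (S kappa : R) (A B : nat -> R -> R) :
  0 < S ->
  (forall k, has_slope_on 0 S (A k) (A k.+1)) ->
  (forall k, has_slope_on 0 S (B k) (B k.+1)) ->
  A 0%N 0 = 0 -> A 1%N 0 = 1 -> A 2%N 0 = 0 -> A 3%N 0 = - kappa ^+ 2 ->
  B 0%N 0 = 0 -> B 1%N 0 = 0 -> B 2%N 0 = kappa ->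
  (fun s => atan (kappa * A 0%N s / (1 - kappa * B 0%N s)) - kappa * s)
    =O_ ((0 : R)^'+) (fun s => s ^+ 4).
Proof.
move=> S0 dA dB A0 A1 A2 A3 B0 B1 B2.
have NO := osculating_defect_bigO S0 dA dB A0 A1 A2 A3 B0 B1 B2.
pose p t := 1 - kappa * B 0%N t.
pose q t := kappa * A 0%N t / p t.
pose D t := p t * p t + kappa ^+ 2 * (A 0%N t * A 0%N t).
pose N t := A 1%N t * p t + kappa * (A 0%N t * B 1%N t) - D t.
have dp : has_slope_on 0 S p (fun t => 0 - kappa * B 1%N t).
  exact: (has_slope_onB (@has_slope_on_cst R 0 S 1) (has_slope_onZ (k := kappa) (dB 0%N))).
have S00 : 0 \in `[0, S] by rewrite in_itv/= lexx ltW.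
have [d [d0 dS phalf]] : exists d, [/\ 0 < d, d <= S &
    {in `[0, d], forall t, 2^-1 <= p t}].
  have /subspace_continuousP/(_ 0 S00) := has_slope_on_continuous dp.
  move/cvgrPdist_lt/(_ 2^-1); rewrite invr_gt0 ltr0n near_withinE => /(_ isT).
  move=> /nbhs_ballP[r /= r0 near_p].
  exists (Num.min S (r / 2)); rewrite lt_min ge_min lexx S0 divr_gt0//; split => //.
  move=> t; rewrite in_itv/= le_min => /and3P[t0 tS tr].
  have tI : t \in `[0, S] by rewrite in_itv/= t0.
  have tball : ball (0 : R) r t by rewrite /ball/= sub0r normrN ger0_norm//; lra.
  have := near_p t tball tI; rewrite /from_subspace [p 0]/p B0 mulr0 subr0.
  by rewrite ltr_distl => /andP[_]; lra.
have p_neq0 t : t \in `[0, d] -> p t != 0.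
  by move=> /phalf pt; rewrite gt_eqF//; lra.
have dq (t : R) : t \in `]0, d[ -> is_derive t 1 q
    ((kappa * A 1%N t * p t + kappa * A 0%N t * (kappa * B 1%N t)) / (p t * p t)).
  move=> td; have pt := p_neq0 t (subset_itv_oo_cc td).
  have tS : t \in `]0, S[.
    by move: td; rewrite !in_itv/= => /andP[-> /lt_le_trans->].
  have dAt := is_deriveZ kappa (has_slope_on_is_derive (dA 0%N) tS).
  have dpt := is_deriveV pt (has_slope_on_is_derive dp tS).
  apply: (is_derive_eq (is_deriveM dAt dpt)).
  by rewrite /= /GRing.scale/=; field.
have contq : {within `[0, d], continuous q}.
  apply/subspace_continuousP => t td.
  have cA : A 0%N u @[u --> within `[0, d] (nbhs t)] --> A 0%N t.
    have := has_slope_on_subitv_continuous (lexx 0) dS (dA 0%N).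
    by move/subspace_continuousP; exact.
  have cp : p u @[u --> within `[0, d] (nbhs t)] --> p t.
    have := has_slope_on_subitv_continuous (lexx 0) dS dp.
    by move/subspace_continuousP; exact.
  exact: (cvgM (cvgM (cvg_cst kappa) cA) (cvgV (p_neq0 t td) cp)).
pose theta s := atan (q s) - kappa * s.
have dtheta (t : R) : t \in `]0, d[ -> is_derive t 1 theta (kappa * (N t / D t)).
  move=> td; have pt := p_neq0 t (subset_itv_oo_cc td).
  have Dt : D t != 0.
    rewrite gt_eqF// ltr_pwDl//; first by rewrite -expr2 exprn_even_gt0.
    by rewrite mulr_ge0 ?sqr_ge0// -expr2 sqr_ge0.
  have dat := is_derive1_comp (is_derive1_atan (q t)) (dq t td).
  have did := is_deriveZ kappa (is_derive_id t (1 : R)).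
  apply: (is_derive_eq (is_deriveB dat did)).
  have -> : 1 + q t ^+ 2 = D t / (p t * p t) by rewrite /q /D; field.
  rewrite /N /= /GRing.scale/=; field.
  by rewrite pt Dt.
have O3 : (fun t => kappa * (N t / D t)) =O_ ((0 : R)^'+) (fun s => s ^+ 3).
  move: NO => /eqO_exP[K K0 NK]; apply/eqO_exP; exists (4 * `|kappa| * K + 1).
    by rewrite ltr_wpDl// !mulr_ge0// ltW.
  near=> s.
  have s0 : 0 < s by [].
  have sd : s \in `[0, d] by rewrite in_itv/= ltW//=; near: s; exact: nbhs_right_le.
  have ps := phalf s sd.
  have Ds : 4^-1 <= D s.
    rewrite /D -expr2 -expr2 -exprMn; have := sqr_ge0 (kappa * A 0%N s); nra.
  have NKs : `|N s| <= K * `|s ^+ 3| by near: s; exact: NK.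
  have Dinv : (D s)^-1 <= 4 by rewrite invf_ple ?posrE//; lra.
  have Dinv0 : 0 <= (D s)^-1 by rewrite invr_ge0; lra.
  apply: (@le_trans _ _ (4 * `|kappa| * K * `|s ^+ 3|)); last first.
    by apply: ler_wpM2r; rewrite // lerDl.
  have -> : 4 * `|kappa| * K * `|s ^+ 3| = `|kappa| * (K * `|s ^+ 3| * 4) by ring.
  rewrite normrM; apply: ler_wpM2l => //.
  by rewrite normrM (ger0_norm Dinv0); apply: ler_pM.
have theta0 : theta 0 = 0.
  by rewrite /theta /q A0 mulr0 mul0r atan0 subr0.
apply: (bigO_primitive d0 _ dtheta theta0 O3).
apply/subspace_continuousP => t td.
have cq : q u @[u --> within `[0, d] (nbhs t)] --> q t.
  by move/subspace_continuousP : contq; exact.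
have catan : atan (q u) @[u --> within `[0, d] (nbhs t)] --> atan (q t).
  by apply: continuous_cvg cq; exact: continuous_atan.
apply: (cvgB catan (cvgM (cvg_cst kappa) _)).
by apply: cvg_within_filter; exact: cvg_id.
Unshelve. all: end_near. Qed.

Lemma acos_cos_atan (R : realType) (x : R) : acos (cos (atan x)) = `|atan x|.
Proof.
have := atan_ltpi2 x; have := atan_gtNpi2 x; have := pi_gt0 R => pi0 lo hi.
have [x0|x0] := leP 0 (atan x).
  by rewrite cosK ?ger0_norm// in_itv/=; apply/andP; split; lra.
by rewrite cosKN ?ltr0_norm//; apply/andP; split; lra.
Qed.

(** In the frame [(T, n)] the vector from the center to [x] is
[(0, - 1 / kappa)] and the vector from the center to [y] is [1 / kappa] times
[(kappa a, - (1 - kappa b))], so the cosine of the angle between them is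
[1 / sqrt (1 + q^2)] for [q = kappa a / (1 - kappa b)], which is
[cos (atan q)]. *)
Lemma sphere_dist_atan (R : realType) (x y T n : 'rV[R]_2) (kappa : R) :
  enorm T = 1 -> enorm n = 1 -> dotp n T = 0 -> kappa != 0 ->
  0 < 1 - kappa * dotp n (y - x) ->
  sphere_dist (x + kappa^-1 *: n) `|kappa|^-1 x y =
  `|kappa|^-1 * `|atan (kappa * dotp T (y - x) / (1 - kappa * dotp n (y - x)))|.
Proof.
move=> T1 n1 nT k0; set a := dotp T (y - x); set p := 1 - _ => p0.
set q := kappa * a / p; set c := x + _.
have nn : dotp n n = 1 by rewrite -enorm_sqr n1 expr1n.
have xc : x - c = - kappa^-1 *: n by rewrite /c opprD addNKr scaleNr.
have yc : y - c = (y - x) - kappa^-1 *: n by rewrite /c opprD addrA.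
have dotpZr k (u v : 'rV[R]_2) : dotp u (k *: v) = k * dotp u v.
  by rewrite !dotpE !mxE; ring.
have dotpZl k (u v : 'rV[R]_2) : dotp (k *: u) v = k * dotp u v.
  by rewrite !dotpE !mxE; ring.
have k'0 : 0 < `|kappa| by rewrite normr_gt0.
have enorm_xc : enorm (x - c) = `|kappa|^-1.
  by rewrite xc /enorm dotpZl dotpZr nn mulr1 -expr2 sqrtr_sqr normrN normfV.
have Tn : dotp T n = 0 by rewrite -nT !dotpE; ring.
have nyc : dotp n (y - c) = - kappa^-1 * p.
  by rewrite yc dotpBr dotpZr nn mulr1 /p; field.
have Tyc : dotp T (y - c) = kappa^-1 * p * q.
  rewrite yc dotpBr dotpZr Tn mulr0 subr0 -/a /q.
  by field; rewrite k0 gt_eqF.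
have enorm_yc : enorm (y - c) = `|kappa|^-1 * p * Num.sqrt (1 + q ^+ 2).
  rewrite /enorm (dotp_orthonormal _ T1 n1 nT) nyc Tyc.
  have -> : (kappa^-1 * p * q) ^+ 2 + (- kappa^-1 * p) ^+ 2 =
    (kappa^-1 * p) ^+ 2 * (1 + q ^+ 2) by ring.
  by rewrite sqrtrM ?sqr_ge0// sqrtr_sqr normrM normfV (gtr0_norm p0).
have sq0 : Num.sqrt (1 + q ^+ 2) != 0.
  by rewrite gt_eqF// sqrtr_gt0 ltr_pwDl// sqr_ge0.
have projE z : `|kappa|^-1^-1 *: (circle_proj c `|kappa|^-1 z - c) =
    (enorm (z - c))^-1 *: (z - c).
  rewrite /circle_proj addrAC subrr add0r scalerA mulVf ?scale1r//.
  by rewrite invr_eq0 gt_eqF.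
rewrite /sphere_dist !projE; congr (_ * _); rewrite -acos_cos_atan cos_atan; congr acos.
rewrite dotpZl dotpZr enorm_xc enorm_yc xc dotpZl nyc.
have kk : `|kappa| * `|kappa| = kappa * kappa by rewrite -normrM ger0_norm// -expr2 sqr_ge0.
transitivity ((`|kappa| * `|kappa|) / (kappa * kappa) * (Num.sqrt (1 + q ^+ 2))^-1).
  by field; rewrite k0 sq0 !gt_eqF.
by rewrite kk divff ?mulf_neq0// mul1r.
Qed.

Lemma sphere_dist_bigO (R : realType) (S : R) (f : R -> 'rV[R]_2)
    (kappa : R) (n : 'rV[R]_2) :
  0 < S -> smooth_on 0 S f -> arc_length_param 0 S f ->
  unit_normal_at 0 S f 0 n -> derive_on_n 0 S 2 f 0 = kappa *: n ->
  kappa != 0 ->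
  (fun s : R => sphere_dist (f 0 + kappa^-1 *: n) `|kappa|^-1 (f 0) (f s))
    = (fun s : R => s) +O_ ((0 : R)^'+) (fun s : R => s ^+ 4).
Proof.
move=> S0 sf uf [n1 nT] f2 k0.
have S00 : 0 \in `[0, S] by rewrite in_itv/= lexx ltW.
set T := derive_on 0 S f 0 in nT.
have T1 : enorm T = 1 by exact: uf.
(* Coordinates of [f - f 0] in the frame [(T, n)] and their derivatives; the
origin is subtracted at order 0 only. *)
pose A k t := dotp T (derive_on_n 0 S k f t) - (if k is 0 then dotp T (f 0) else 0).
pose B k t := dotp n (derive_on_n 0 S k f t) - (if k is 0 then dotp n (f 0) else 0).
have dframe (w : 'rV[R]_2) k : has_slope_on 0 S
    (fun t => dotp w (derive_on_n 0 S k f t) - (if k is 0 then dotp w (f 0) else 0))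
    (fun t => dotp w (derive_on_n 0 S k.+1 f t) - 0).
  case: k => [|k]; exact: has_slope_onB (smooth_on_dotp sf) (@has_slope_on_cst _ _ _ _).
have A0 : A 0%N 0 = 0 by rewrite /A subrr.
have A1 : A 1%N 0 = 1 by rewrite /A subr0 -[dotp _ _]enorm_sqr T1 expr1n.
have dotp_kn w : dotp w (kappa *: n) = kappa * dotp w n by rewrite !dotpE !mxE; ring.
have Tn : dotp T n = 0 by rewrite -nT !dotpE; ring.
have nn : dotp n n = 1 by rewrite -enorm_sqr n1 expr1n.
have A2 : A 2%N 0 = 0 by rewrite /A subr0 f2 dotp_kn Tn mulr0.
have A3 : A 3%N 0 = - kappa ^+ 2.
  rewrite /A subr0 [LHS](arc_length_third_derivative S0 sf uf S00) f2.
  have dotp_nk : dotp (kappa *: n) n = kappa * dotp n n by rewrite !dotpE !mxE; ring.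
  by rewrite dotp_kn dotp_nk nn mulr1.
have B0 : B 0%N 0 = 0 by rewrite /B subrr.
have B1 : B 1%N 0 = 0 by rewrite /B subr0.
have B2 : B 2%N 0 = kappa by rewrite /B subr0 f2 dotp_kn nn mulr1.
have := osculating_angle_bigO S0 (dframe T) (dframe n) A0 A1 A2 A3 B0 B1 B2.
move=> /eqO_exP[K K0 thetaK]; apply/eqaddOP.
suff near_K : \forall s \near (0 : R)^'+,
    `|sphere_dist (f 0 + kappa^-1 *: n) `|kappa|^-1 (f 0) (f s) - s|
      <= `|kappa|^-1 * K * `|s ^+ 4|.
  near=> k; move: near_K; apply: filterS => s /le_trans; apply.
  by apply: ler_wpM2r => //; near: k; exact: nbhs_pinfty_ge.
have near_p : \forall s \near (0 : R)^'+, 0 < 1 - kappa * B 0%N s.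
  have := has_slope_on_continuous (has_slope_onZ (k := kappa) (dframe n 0%N)).
  move=> /subspace_continuousP/(_ 0 S00)/cvgrPdist_lt/(_ 1 ltr01).
  rewrite near_withinE => near_kB; rewrite near_withinE.
  apply: filterS2 near_kB (lt_nbhsl S0) => s kB sS s0.
  have sI : s \in `[0, S] by rewrite in_itv/= !ltW.
  have := kB sI; rewrite /from_subspace -/(B 0%N 0) -/(B 0%N s) B0 mulr0 sub0r normrN.
  by rewrite subr_gt0 => /(le_lt_trans (ler_norm _)).
near=> s.
have s0 : 0 < s by [].
have p0 : 0 < 1 - kappa * dotp n (f s - f 0) by rewrite dotpBr; near: s.
rewrite (sphere_dist_atan T1 n1 nT k0 p0).
have : `|atan (kappa * A 0%N s / (1 - kappa * B 0%N s)) - kappa * s| <=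
    K * `|s ^+ 4| by near: s.
rewrite -/(A 0%N s) !dotpBr -/(A 0%N s) -/(B 0%N s).
set theta := atan _ => thetas.
rewrite [X in _ - X](_ : s = `|kappa|^-1 * `|kappa * s|); last first.
  by rewrite normrM (gtr0_norm s0) mulKf// normr_eq0.
rewrite -mulrBr normrM normfV normr_id -mulrA; apply: ler_wpM2l.
  by rewrite invr_ge0.
exact: le_trans (ler_dist_dist _ _) thetas.
Unshelve. all: end_near. Qed.

Theorem theorem2 (R : realType) (S : R) (gamma : R -> 'rV[R]_2)
    (kappa : R) (n : 'rV[R]_2) :
  0 < S ->
  smooth_on 0 S gamma ->
  arc_length_param 0 S gamma ->
  unit_normal_at 0 S gamma 0 n ->
  derive_on_n 0 S 2 gamma 0 = kappa *: n ->
  kappa != 0 ->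
  let M : set 'rV[R]_2 := [set gamma t | t in `[0, S]] in
  let x : 'rV[R]_2 := gamma 0 in
  let r : R := `|kappa|^-1 in
  let c : 'rV[R]_2 := x + kappa^-1 *: n in
  [/\ {in `[0, S] &, injective gamma} ->
        forall s : R, s \in `[0, S] -> geodesic_dist M x (gamma s) = s%:E,
      {in `[0, S[ &, injective gamma} ->
        \forall s \near (0 : R)^'+, geodesic_dist M x (gamma s) = s%:E &
      (fun s : R => sphere_dist c r x (gamma s))
        = (fun s : R => s) +O_ ((0 : R)^'+) (fun s : R => s ^+ 4)].
Proof.
move=> S0 sf uf nP f2 k0 M x r c; split.
- by move=> injf s sS; exact: geodesic_dist_injective.
- exact: geodesic_dist_near.
- exact: (sphere_dist_bigO S0 sf uf nP f2 k0).
Qed.
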